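(* Let $\gamma\in[0,2]$, let $\mathcal{O}\subset\mathbb{R}^d$ be a domain, let $\theta_1,\theta_2,\theta_3$ be positive constants and $\beta\in(0,3-\gamma]$. Suppose that $u$ is a bounded function satisfying, in the viscosity sense, $$\Delta_\infty^\gamma u\ge-\theta_1|\nabla u|^\beta-\theta_2|u|-\theta_3\quad\text{in }\mathcal{O}.$$ Then $u$ is locally Lipschitz in $\mathcal{O}$, with local Lipschitz constant depending on $\theta_1,\theta_2,\theta_3$ and $\|u\|_{L^\infty(\mathcal{O})}$. (That is, on each compact $K\subset\mathcal{O}$ the Lipschitz constant of $u$ is bounded by a constant which depends on $u$ only through $\|u\|_{L^\infty(\mathcal{O})}$, the other dependencies being on $\theta_i$ and on $K,\mathcal{O},\gamma,\beta$.)
   Context: For a $C^2$ function $\varphi$, $\Delta_\infty^\gamma\varphi=|\nabla\varphi|^{-\gamma}\sum_{i,j=1}^d\partial_{x_i}\varphi\,\partial_{x_ix_j}\varphi\,\partial_{x_j}\varphi$. Viscosity sense: an upper-semicontinuous $u$ satisfies $\Delta_\infty^\gamma u+G(x,u,\nabla u)\ge0$ in an open set $U\subset\mathbb{R}^d$ (with $G$ continuous) if, whenever $x_0\in U$ and $\varphi$ is $C^2$ near $x_0$ with $u(x_0)=\varphi(x_0)$ and $u<\varphi$ in a punctured ball around $x_0$, one has $\Delta_\infty^\gamma\varphi(x_0)+G(x_0,u(x_0),\nabla\varphi(x_0))\ge0$; if $\nabla\varphi(x_0)=0$, the term $\Delta_\infty^\gamma\varphi(x_0)$ is read as $0$ when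 $\gamma<2$ and as $M(D^2\varphi(x_0))=\max_{|\xi|=1}\langle\xi,D^2\varphi(x_0)\xi\rangle$ when $\gamma=2$. *)

(* Defs.v *)
From HB Require Import structures.
From mathcomp Require Import all_boot all_order all_algebra.
From mathcomp Require Import all_classical all_reals all_analysis.

Set Implicit Arguments.
Unset Strict Implicit.
Unset Printing Implicit Defensive.

Import Order.TTheory GRing.Theory Num.Theory.
Import numFieldNormedType.Exports.

Local Open Scope classical_set_scope.
Local Open Scope ring_scope.

(* The library norm `|x| on 'rV[R]_d is the sup norm: it induces the right
   topology, but |grad phi|, |xi| and Lipschitz constants are Euclidean. *)
Definition enorm (R : realType) (d : nat) (x : 'rV[R]_d) : R :=
  Num.sqrt (\sum_(i < d) x 0 i ^+ 2).

Definition partial (R : realType) (d : nat) (i : 'I_d) (f : 'rV[R]_d -> R)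
    (x : 'rV[R]_d) : R :=
  'D_(delta_mx 0 i) f x.

Definition grad (R : realType) (d : nat) (f : 'rV[R]_d -> R)
    (x : 'rV[R]_d) : 'rV[R]_d :=
  \row_i partial i f x.

Definition hess (R : realType) (d : nat) (f : 'rV[R]_d -> R)
    (x : 'rV[R]_d) : 'M[R]_d :=
  \matrix_(i, j) partial i (partial j f) x.

(* 'D_v is a total operator, so existence of the partial derivatives has to be
   required separately. *)
Definition C2_near (R : realType) (d : nat) (f : 'rV[R]_d -> R)
    (x0 : 'rV[R]_d) : Prop :=
  \forall x \near x0,
    {for x, continuous f} /\
    forall i : 'I_d,
      [/\ derivable f x (delta_mx 0 i),
          {for x, continuous (partial i f)} &
          forall j : 'I_d,
            derivable (partial i f) x (delta_mx 0 j) /\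
            {for x, continuous (partial j (partial i f))}].

Definition quad_form (R : realType) (d : nat) (A : 'M[R]_d)
    (xi : 'rV[R]_d) : R :=
  \sum_(i < d) \sum_(j < d) xi 0 i * A i j * xi 0 j.

(* For d > 0 the supremum is attained, by compactness of the unit sphere. *)
Definition max_quad (R : realType) (d : nat) (A : 'M[R]_d) : R :=
  sup [set quad_form A xi | xi in [set xi : 'rV[R]_d | enorm xi = 1]].

(* Delta_infty^gamma phi (x), for 0 <= gamma <= 2, with the viscosity
   convention where the gradient vanishes. *)
Definition inf_laplacian (R : realType) (d : nat) (gamma : R)
    (phi : 'rV[R]_d -> R) (x : 'rV[R]_d) : R :=
  if grad phi x == 0 then
    (if gamma < 2 then 0 else max_quad (hess phi x))
  else enorm (grad phi x) `^ (- gamma) * quad_form (hess phi x) (grad phi x).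

Definition usc_on (R : realType) (d : nat) (U : set 'rV[R]_d)
    (u : 'rV[R]_d -> R) : Prop :=
  forall x, U x -> forall a, u x < a -> \forall y \near x, u y < a.

(* Delta_infty^gamma u + G(x, u, grad u) >= 0 in the open set U.  Since U is
   open, the values of u outside U are irrelevant. *)
Definition viscosity_subsol (R : realType) (d : nat) (gamma : R)
    (G : 'rV[R]_d -> R -> 'rV[R]_d -> R) (U : set 'rV[R]_d)
    (u : 'rV[R]_d -> R) : Prop :=
  usc_on U u /\
  forall (x0 : 'rV[R]_d) (phi : 'rV[R]_d -> R),
    U x0 -> C2_near phi x0 -> u x0 = phi x0 ->
    (\forall x \near x0^', u x < phi x) ->
    0 <= inf_laplacian gamma phi x0 + G x0 (u x0) (grad phi x0).

Definition domain (R : realType) (d : nat) (O : set 'rV[R]_d) : Prop :=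
  [/\ O !=set0, open O & connected O].

Definition sup_norm (R : realType) (d : nat) (O : set 'rV[R]_d)
    (u : 'rV[R]_d -> R) : R :=
  sup [set `|u x| | x in O].

(* Main.v *)
Require Import Defs.
From HB Require Import structures.
From mathcomp Require Import all_boot all_order all_algebra.
From mathcomp Require Import all_classical all_reals all_analysis.
From mathcomp Require Import ring lra.

Import Order.TTheory GRing.Theory Num.Theory.
Import numFieldNormedType.Exports.

Local Open Scope classical_set_scope.
Local Open Scope ring_scope.

(* Compare u near y with the concave radial barrier
   psi(s) = A s - (B/2) s^2, s = |x - y|, on a small ball of radius r.  Where
   psi' >= 1, beta <= 3 - gamma gives psi'^beta <= A psi'^(2-gamma), so that
   psi(|x - y|) is a strict supersolution once
   B > theta1 A + theta2 |u|_oo + theta3; this is compatible with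
   psi' >= A - B r >= 1 as soon as theta1 r <= 1/2.  If A is moreover so large
   that psi(r) >= 2 |u|_oo, then u - psi(|x - y|) can attain its maximum only at
   y, hence u(x) <= u(y) + A |x - y|.  Points at distance more than r are
   handled by |u(x) - u(y)| <= 2 |u|_oo. *)

(** * The Euclidean inner product and norm on row vectors *)

Section Dot.
Context {R : realType} {d : nat}.
Implicit Types x y z v e : 'rV[R]_d.

Definition dot x y : R := \sum_(i < d) x 0 i * y 0 i.

Lemma dotC x y : dot x y = dot y x.
Proof. by apply: eq_bigr => i _; rewrite mulrC. Qed.

Lemma dotDl x y z : dot (x + y) z = dot x z + dot y z.
Proof. by rewrite -big_split; apply: eq_bigr => i _; rewrite mxE mulrDl. Qed.

Lemma dotZl k x y : dot (k *: x) y = k * dot x y.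
Proof. by rewrite mulr_sumr; apply: eq_bigr => i _; rewrite mxE mulrA. Qed.

Lemma dotDr x y z : dot x (y + z) = dot x y + dot x z.
Proof. by rewrite dotC dotDl !(dotC _ x). Qed.

Lemma dotZr k x y : dot x (k *: y) = k * dot x y.
Proof. by rewrite dotC dotZl dotC. Qed.

Lemma dot0r x : dot x 0 = 0.
Proof. by rewrite -(scale0r 0) dotZr mul0r. Qed.

Lemma dotNl x y : dot (- x) y = - dot x y.
Proof. by rewrite -scaleN1r dotZl mulN1r. Qed.

Lemma dotNr x y : dot x (- y) = - dot x y.
Proof. by rewrite dotC dotNl dotC. Qed.

Lemma dot_delta x i : dot x (delta_mx 0 i) = x 0 i.
Proof.
rewrite /dot (bigD1 i) //= big1 ?addr0 => [|j ji].
  by rewrite mxE !eqxx mulr1.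
rewrite mxE eqxx /=.
by rewrite (negbTE ji) mulr0.
Qed.

Lemma dot_ge0 x : 0 <= dot x x.
Proof. by apply: sumr_ge0 => i _; rewrite -expr2 sqr_ge0. Qed.

Lemma dot_eq0 x : (dot x x == 0) = (x == 0).
Proof.
apply/idP/eqP => [|->]; last by rewrite dot0r.
rewrite psumr_eq0 => [/allP h|i _]; last by rewrite -expr2 sqr_ge0.
apply/rowP => i; rewrite mxE; apply/eqP.
by have := h i; rewrite mem_index_enum mulf_eq0 orbb; apply.
Qed.

(** The component of x orthogonal to the unit vector e has a nonnegative squared norm. *)
Lemma sqr_dot_le e x : dot e e = 1 -> dot e x ^+ 2 <= dot x x.
Proof.
move=> ee; have := dot_ge0 (x - dot e x *: e).
rewrite !(dotDl, dotDr, dotNl, dotNr, dotZl, dotZr) ee (dotC x); lra.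
Qed.

Lemma enormE x : enorm x = Num.sqrt (dot x x).
Proof. by []. Qed.

Lemma enorm_ge0 x : 0 <= enorm x.
Proof. exact: sqrtr_ge0. Qed.

Lemma sqr_enorm x : enorm x ^+ 2 = dot x x.
Proof. by rewrite enormE sqr_sqrtr ?dot_ge0. Qed.

Lemma enorm_eq0 x : (enorm x == 0) = (x == 0).
Proof. by rewrite -dot_eq0 -sqr_enorm sqrf_eq0. Qed.

Lemma enorm0 : enorm (0 : 'rV[R]_d) = 0.
Proof. by apply/eqP; rewrite enorm_eq0. Qed.

Lemma enormN x : enorm (- x) = enorm x.
Proof. by rewrite !enormE dotNl dotNr opprK. Qed.

Lemma enormZ k x : enorm (k *: x) = `|k| * enorm x.
Proof.
by rewrite !enormE dotZl dotZr mulrA -expr2 sqrtrM ?sqr_ge0 // sqrtr_sqr.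
Qed.

(** The sup norm is attained at some coordinate, whose square is one term of the sum under the root.
    This lets sup-norm facts be used on Euclidean balls. *)
Lemma normr_le_enorm x : `|x| <= enorm x.
Proof.
have [->|x0] := eqVneq x 0; first by rewrite normr0 enorm_ge0.
have [[i j] xE] : exists ij, `|x| = `|x ij.1 ij.2|.
  by apply: (@mx_norm_neq0 _ _ _ x); rewrite -[mx_norm x]/`|x| normr_eq0.
rewrite xE /= (ord1 i) -sqrtr_sqr ler_wsqrtr // (bigD1 j) //= lerDl.
by apply: sumr_ge0 => l _; exact: sqr_ge0.
Qed.

Lemma dot_continuous (f g : 'rV[R]_d -> 'rV[R]_d) :
  continuous f -> continuous g -> continuous (fun x => dot (f x) (g x)).
Proof.
move=> cf cg; apply: continuous_big => [|i _]; first exact: add_continuous.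
move=> x; apply: continuousM.
  by apply: (@continuous_comp _ _ _ f (fun M : 'rV[R]_d => M 0 i));
    [exact: cf|exact: coord_continuous].
by apply: (@continuous_comp _ _ _ g (fun M : 'rV[R]_d => M 0 i));
    [exact: cg|exact: coord_continuous].
Qed.

Lemma enorm_continuous : continuous (@enorm R d).
Proof.
move=> x; apply: (@continuous_comp _ _ _ (fun x => dot x x) Num.sqrt).
  by apply: (dot_continuous id id) => ?; exact: cvg_id.
exact: sqrt_continuous.
Qed.

End Dot.

(** * Quadratic test functions: regularity, gradient and infinity Laplacian *)

Lemma continuous_poly2 {R : numFieldType} {T : topologicalType} (f g : T -> R)
    (c k a m : R) (x : T) :
  {for x, continuous f} -> {for x, continuous g} ->
  {for x, continuous (fun z => c + k * f z + a * f z ^+ 2 + m * g z)}.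
Proof.
move=> cf cg; apply: cvgD; [apply: cvgD; [apply: cvgD|]|].
- exact: cvg_cst.
- by apply: cvgM; [exact: cvg_cst|exact: cf].
- apply: cvgM; [exact: cvg_cst|exact: (cvgM cf cf)].
- by apply: cvgM; [exact: cvg_cst|exact: cg].
Qed.

Section Quadratic.
Context {R : realType} {d : nat}.
Implicit Types x y z v e : 'rV[R]_d.

(** For h != 0 the difference quotient is exactly D + h Q. *)
Lemma is_derive_quadratic (f : 'rV[R]_d -> R) x v (D Q : R) :
  (forall h : R, f (h *: v + x) = f x + h * D + h ^+ 2 * Q) ->
  is_derive x v f D.
Proof.
move=> fE.
have cv : h^-1 *: ((f \o shift x) (h *: v) - f x) @[h --> 0^'] --> D.
  apply: (@cvg_trans _ ((D + h * Q) @[h --> (0 : R)^'])).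
    apply: near_eq_cvg; near=> h.
    have h0 : h != 0 by near: h; exact: nbhs_dnbhs_neq.
    by rewrite /= fE /GRing.scale /=; field.
  suff : D + h * Q @[h --> (0 : R)^'] --> D + 0 * Q by rewrite mul0r addr0.
  apply: cvgD; first exact: cvg_cst.
  by apply: cvgM; [exact: cvg_within|exact: cvg_cst].
by apply: DeriveDef; [exact: cvgP cv|exact: cvg_lim cv].
Unshelve. all: by end_near. Qed.

(** A jet at [x0] with gradient k e and Hessian 2 a e⊗e + 2 m I: the shape taken by the Hessian of a
    radial function whose radial direction is e. *)
Definition quadratic (c k a m : R) e x0 x : R :=
  c + k * dot e (x - x0) + a * dot e (x - x0) ^+ 2
    + m * dot (x - x0) (x - x0).

Variables (c k a m : R) (e x0 : 'rV[R]_d).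
Local Notation q := (quadratic c k a m e x0).

Definition quadratic_slope i x : R :=
  k * e 0 i + 2 * a * dot e (x - x0) * e 0 i + 2 * m * (x - x0) 0 i.

Lemma is_derive_quadratic1 i x :
  is_derive x (delta_mx 0 i) q (quadratic_slope i x).
Proof.
apply: (@is_derive_quadratic _ _ _ _ (a * e 0 i ^+ 2 + m)) => h.
rewrite /quadratic /quadratic_slope -(addrA (h *: _)).
move: (x - x0) => y.
rewrite !(dotDl, dotDr) !(dotZl, dotZr) !(dotC (delta_mx _ _)) !dot_delta.
rewrite !mxE !eqxx /=; ring.
Qed.

Lemma is_derive_quadratic2 i j x :
  is_derive x (delta_mx 0 j) (quadratic_slope i)
    (2 * a * e 0 i * e 0 j + 2 * m * (i == j)%:R).
Proof.
apply: (@is_derive_quadratic _ _ _ _ 0) => h.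
rewrite /quadratic_slope -(addrA (h *: _)) (dotDr _ (h *: _)) dotZr dot_delta.
rewrite !mxE eqxx /=; ring.
Qed.

Lemma partial_quadratic i : partial i q = quadratic_slope i.
Proof. by apply/funext => x; have [] := is_derive_quadratic1 i x. Qed.

Lemma partial2_quadratic i j :
  partial j (partial i q) = cst (2 * a * e 0 i * e 0 j + 2 * m * (i == j)%:R).
Proof.
rewrite partial_quadratic; apply/funext => x.
by have [] := is_derive_quadratic2 i j x.
Qed.

Lemma sub_continuous x : continuous (fun z => z - x).
Proof.
move=> z; apply: (@continuousB R 'rV[R]_d 'rV[R]_d id (cst x)).
  by move=> ?; apply.
exact: cst_continuous.
Qed.

Lemma quadratic_C2 x : C2_near q x.
Proof.
have cs := @sub_continuous x0.
have ce : continuous (fun z => dot e (z - x0)).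
  apply: (dot_continuous (fun=> e) (fun z => z - x0)) => //.
  exact: cst_continuous.
have cN : continuous (fun z => dot (z - x0) (z - x0)).
  exact: (dot_continuous (fun z => z - x0) (fun z => z - x0)).
apply: (@filterE _ (nbhs x)) => z; split.
  exact: continuous_poly2 (ce z) (cN z).
move=> i; split.
- by have [] := is_derive_quadratic1 i z.
- rewrite partial_quadratic.
  have -> : quadratic_slope i = fun z => k * e 0 i + 2 * a * e 0 i * dot e (z - x0)
      + 0 * dot e (z - x0) ^+ 2 + 2 * m * (z - x0) 0 i.
    by apply/funext => ?; rewrite /quadratic_slope; ring.
  apply: continuous_poly2; first exact: ce.
  apply: (@continuous_comp _ _ _ (fun z => z - x0) (fun M : 'rV[R]_d => M 0 i)).
    exact: cs.
  exact: coord_continuous.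
- move=> j; split; last by rewrite partial2_quadratic; exact: cst_continuous.
  by rewrite partial_quadratic; have [] := is_derive_quadratic2 i j z.
Qed.

Lemma grad_quadratic : grad q x0 = k *: e.
Proof.
apply/rowP => i; rewrite !mxE partial_quadratic /quadratic_slope subrr mxE.
by rewrite dot0r !mulr0 mul0r !addr0.
Qed.

Lemma quad_form_hess_quadratic v :
  quad_form (hess q x0) v = 2 * a * dot e v ^+ 2 + 2 * m * dot v v.
Proof.
rewrite /quad_form.
transitivity (\sum_(i < d) (2 * a * dot e v * (e 0 i * v 0 i)
                            + 2 * m * (v 0 i * v 0 i))).
  apply: eq_bigr => i _.
  (* The Kronecker delta is written as a coordinate of [delta_mx 0 i], so that the second sum
     becomes an inner product. *)
  transitivity (\sum_(j < d) (2 * a * (e 0 i * v 0 i) * (e 0 j * v 0 j)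
     + 2 * m * v 0 i * (v 0 j * (delta_mx 0 i : 'rV[R]_d) 0 j))).
    apply: eq_bigr => j _; rewrite mxE partial2_quadratic mxE eqxx /=; ring.
  rewrite big_split -!mulr_sumr /= -/(dot e v) -/(dot v (delta_mx 0 i)) dot_delta.
  ring.
rewrite big_split -!mulr_sumr /= -/(dot e v) -/(dot v v); ring.
Qed.

(** On the gradient k e the Hessian form equals k^2 (2 a + 2 m), and the weight k^(-gamma) completes
    the power. As k > 0, the convention for vanishing gradients never enters. *)
Lemma inf_laplacian_quadratic (gamma : R) : 0 < k -> enorm e = 1 ->
  inf_laplacian gamma q x0 = k `^ (2 - gamma) * (2 * (a + m)).
Proof.
move=> k0 e1; have ee : dot e e = 1 by rewrite -sqr_enorm e1 expr1n.
rewrite /inf_laplacian grad_quadratic scaler_eq0 gt_eqF //= -enorm_eq0 e1 oner_eq0.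
rewrite quad_form_hess_quadratic enormZ gtr0_norm // e1 mulr1 dotZl !dotZr ee mulr1.
have -> : k `^ (2 - gamma) = k `^ (- gamma) * k ^+ 2.
  rewrite addrC powRD ?powR_mulrn ?ltW //.
  by apply/implyP => _; rewrite gt_eqF.
ring.
Qed.

End Quadratic.

(** * Compactness: attained maxima and a uniform radius *)

Lemma usc_compact_max (R : realType) (T : topologicalType) (C : set T)
    (w : T -> R) :
  compact C -> C !=set0 -> has_ubound (w @` C) ->
  (forall x, C x -> forall a, w x < a -> \forall z \near x, w z < a) ->
  exists2 x, C x & forall z, C z -> w z <= w x.
Proof.
move=> cC [c Cc] wub wusc; set S := sup (w @` C).
have wS z : C z -> w z <= S.
  by move=> Cz; apply: ub_le_sup => //; exists z.
have [[x Cx Sx]|nS] := pselect (exists2 x, C x & S <= w x).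
  by exists x => // z /wS zS; exact: le_trans Sx.
(* If S is not attained, w stays below the midpoint of [w x] and S near each x; compactness then
   yields a single level i < S above w on all of C. *)
have : \forall i \near S^'-, C `<=` [set z | w z < i].
  have /compact_near_coveringP cov := cC.
  apply: (cov R S^'- (fun i z => w z < i)) => x Cx.
  have wxS : w x < S by rewrite ltNge; apply/negP => Sx; apply: nS; exists x.
  exists ([set z | w z < (w x + S) / 2], [set i | (w x + S) / 2 < i]).
    split => /=; first by apply: wusc => //; lra.
    by apply: nbhs_left_gt; lra.
  by move=> [z i] /= [wz iS]; exact: lt_trans iS.
move=> /(filterI (nbhs_left_lt S)) /filter_ex [i [iS Ci]].
have : S <= i.
  by apply: ge_sup; [exists (w c), c|move=> _ [z Cz <-]; exact/ltW/Ci].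
by rewrite leNgt iS.
Qed.

Lemma compact_open_radius {R : realType} {V : normedModType R} (K O : set V) :
  compact K -> open O -> K `<=` O ->
  exists2 r : R, 0 < r & forall y x, K y -> `|x - y| <= r -> O x.
Proof.
move=> /compact_near_coveringP cov oO KO.
have : \forall r \near 0^'+, K `<=` [set y | forall x, `|x - y| <= r -> O x].
  apply: (cov R 0^'+ (fun r y => forall x, `|x - y| <= r -> O x)) => y Ky.
  have /nbhs_ballP[/= eps eps0 epsO] : nbhs y O.
    by apply: open_nbhs_nbhs; split => //; exact: KO.
  exists (ball y (eps / 2), [set r | r < eps / 2]).
    by split => /=; [apply: nbhsx_ballx|apply: nbhs_right_lt]; rewrite divr_gt0.
  move=> [z r] /= [yz reps] x xz; apply: epsO.
  apply: (@ball_splitr _ _ z) => //; first exact: ball_sym.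
  by rewrite -ball_normE /= distrC; exact: le_lt_trans reps.
move=> /(filterI (nbhs_right_gt 0)) /filter_ex [r [r0 rK]].
by exists r => // y x Ky; exact: rK.
Qed.

(** * The concave radial barrier and smooth functions touching it from above *)

Section Barrier.
Context {R : realType} {d : nat}.
Implicit Types x y z v e : 'rV[R]_d.

Lemma enorm_sub_continuous y : continuous (fun x => enorm (x - y)).
Proof.
move=> x; apply: (@continuous_comp _ _ _ (fun z => z - y) (@enorm R d)).
  exact: sub_continuous.
exact: enorm_continuous.
Qed.

Lemma compact_enorm_ball y (r : R) : compact [set x | enorm (x - y) <= r].
Proof.
apply: bounded_closed_compact.
  exists (`|y| + r); split; first exact: num_real.
  move=> M yM x /= xr; apply/ltW/(le_lt_trans _ yM).
  rewrite -[x](subrK y) addrC (le_trans (ler_normD _ _))// lerD2l.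
  exact: le_trans (normr_le_enorm _) xr.
apply: (@closed_comp _ _ (fun x => enorm (x - y)) [set t | t <= r]).
  by move=> x _; exact: enorm_sub_continuous.
exact: closed_le.
Qed.

Variables A B : R.
Hypothesis A0 : 0 < A.

Definition barrier (s : R) : R := A * s - B / 2 * s ^+ 2.

Lemma barrier_continuous : continuous barrier.
Proof.
move=> s; apply: cvgB; apply: cvgM; (try exact: cvg_cst); first exact: cvg_id.
exact: (cvgM cvg_id cvg_id).
Qed.

(* A quadratic with the gradient of c + psi(|x - y|) at x0.  Its Hessian exceeds
   the true one in tangential directions, which the infinity Laplacian does not
   see, and by the identity (the - 1 in B - 1), to make the contact strict. *)
Definition barrier_jet (c : R) x0 y : 'rV[R]_d -> R :=
  let s := enorm (x0 - y) in
  quadratic c (A - B * s) (- (A / s)) (A / s - (B - 1) / 2)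
    (s^-1 *: (x0 - y)) x0.

(** With t = |x - y|, a = <e, x - x0> and N = |x - x0|^2, one has t^2 = (s + a)^2 + (N - a^2), hence
    t <= s + a + (N - a^2) / s near [x0]. The jet then exceeds the barrier by at least N / 2 > 0. *)
Lemma barrier_jet_touches (c : R) x0 y : x0 != y ->
  \forall x \near x0^',
    c + (barrier (enorm (x - y)) - barrier (enorm (x0 - y)))
    < barrier_jet c x0 y x.
Proof.
move=> x0y; rewrite /barrier_jet /barrier; set s := enorm (x0 - y).
have s0 : 0 < s by rewrite lt_def enorm_ge0 enorm_eq0 subr_eq0 x0y.
set e := s^-1 *: (x0 - y).
have ey : x0 - y = s *: e by rewrite scalerA divff ?gt_eqF // scale1r.
have ee : dot e e = 1.
  by rewrite -sqr_enorm enormZ gtr0_norm ?invr_gt0 // mulVf ?expr1n ?gt_eqF.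
move: e ey ee => e ey ee.
(* This gives 2 (s + a) > s, so that the denominator 2 (s + a) from linearising the square root can
   be replaced by s. *)
have : \forall x \near x0^', - (s / 2) < dot e (x - x0).
  apply: nbhs_dnbhs.
  have : {for x0, continuous (fun x => dot e (x - x0))}.
    apply: (dot_continuous (fun=> e) (fun z => z - x0)); last exact: sub_continuous.
    exact: cst_continuous.
  move=> /cvgrPdist_lt /(_ _ (divr_gt0 s0 (ltr0Sn R 1))) h.
  near=> x; have : `|dot e (x0 - x0) - dot e (x - x0)| < s / 2 by near: x; exact: h.
  rewrite subrr dot0r sub0r normrN ltr_norml.
  by case/andP.
move=> near_a.
near=> x.
have xx0 : x != x0 by near: x; exact: nbhs_dnbhs_neq.
have a_gt : - (s / 2) < dot e (x - x0) by near: x.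
rewrite /quadratic; set a := dot e (x - x0) in a_gt *.
set N := dot (x - x0) (x - x0).
have N_gt0 : 0 < N by rewrite lt_def dot_ge0 dot_eq0 subr_eq0 xx0.
have aN : 0 <= N - a ^+ 2.
  by rewrite subr_ge0; exact: sqr_dot_le.
have tE : enorm (x - y) ^+ 2 = s ^+ 2 + 2 * s * a + N.
  rewrite sqr_enorm (_ : x - y = (x - x0) + s *: e); last by rewrite -ey subrKA.
  rewrite /a /N; move: (x - x0) => h.
  rewrite !(dotDl, dotDr, dotZl, dotZr) ee (dotC _ e); ring.
move: (enorm (x - y)) tE => t tE.
have t_le : t <= s + a + (N - a ^+ 2) / s.
  have m0 : 0 < s + a by lra.
  have : 2 * (s + a) * t <= 2 * (s + a) ^+ 2 + (N - a ^+ 2).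
    by have := sqr_ge0 (t - (s + a)); nra.
  have : N - a ^+ 2 <= 2 * (s + a) * ((N - a ^+ 2) / s).
    rewrite mulrCA ler_peMr // mulrC ler_pdivlMl //; lra.
  move: (_ / s) => q qN tN.
  by rewrite -(ler_pM2l (mulr_gt0 (ltr0Sn R 1) m0)); nra.
rewrite tE -subr_gt0.
have -> : - (A / s) * a ^+ 2 = - (A * (a ^+ 2 / s)) by ring.
have -> : (A / s - (B - 1) / 2) * N = A * (N / s) - (B - 1) / 2 * N by ring.
have := ler_wpM2l (ltW A0) t_le.
rewrite mulrBl !mulrDr mulrN => h.
lra.
Unshelve. all: by end_near. Qed.

End Barrier.

(** * Comparison with the barrier on one ball *)

Section LocalBound.
Context {R : realType} {d : nat}.
Variables (gamma theta1 theta2 theta3 beta : R).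
Hypotheses (gamma_le2 : gamma <= 2) (beta_le : beta <= 3 - gamma).
Hypotheses (theta1_ge0 : 0 <= theta1) (theta2_ge0 : 0 <= theta2).
Hypothesis theta3_ge0 : 0 <= theta3.

(** Since k >= 1, k^beta <= k^(3 - gamma) = k k^(2 - gamma) <= A k^(2 - gamma), while the other
    terms only grow when multiplied by k^(2 - gamma) >= 1. What remains is at most - k^(2 -
    gamma). *)
Lemma supersolution_slope (A k : R) (M r : R) : 1 <= k <= A -> `|r| <= M ->
  k `^ (2 - gamma) * - (theta1 * A + theta2 * M + theta3 + 1)
  + (theta1 * k `^ beta + theta2 * `|r| + theta3) < 0.
Proof.
move=> /andP[k1 kA] rM; have k0 : 0 < k by lra.
have P1 : 1 <= k `^ (2 - gamma).
  by rewrite -[leLHS](powRr0 k); apply: ler_powR; rewrite ?subr_ge0.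
have kb : k `^ beta <= A * k `^ (2 - gamma).
  apply: (@le_trans _ _ (k * k `^ (2 - gamma))); last first.
    by apply: ler_wpM2r => //; exact: powR_ge0.
  rewrite (_ : 2 - gamma = 3 - gamma - 1); last by ring.
  rewrite mulr_powRB1 ?(ltW k0) //; last by move: gamma_le2; lra.
  exact: ler_powR.
move: (k `^ (2 - gamma)) (k `^ beta) P1 kb => P Q P1 kb.
have h1 := ler_wpM2l theta1_ge0 kb.
have h2 : theta2 * `|r| <= theta2 * M * P.
  have M0 : 0 <= M := le_trans (normr_ge0 _) rM.
  rewrite -mulrA; apply: ler_wpM2l => //; apply: (le_trans rM).
  by rewrite ler_peMr.
have h3 : theta3 <= theta3 * P by rewrite ler_peMr.
lra.
Qed.

(** Of the final 2 in B, one unit pays for the strict contact of [barrier_jet] and the other for the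
    strict inequality in [supersolution_slope]. *)
Lemma viscosity_local_bound (O : set 'rV[R]_d) (u : 'rV[R]_d -> R)
    (M A r : R) y :
  let B := theta1 * A + theta2 * M + theta3 + 2 in
  viscosity_subsol gamma
    (fun _ t p => theta1 * enorm p `^ beta + theta2 * `|t| + theta3) O u ->
  (forall x, O x -> `|u x| <= M) ->
  (forall x, enorm (x - y) <= r -> O x) ->
  0 < A -> 0 < r -> 1 <= A - B * r -> 2 * M <= barrier A B r ->
  forall x, enorm (x - y) <= r -> u x <= u y + A * enorm (x - y).
Proof.
move=> B [uusc uvisc] uM yO A0 r0 slope_r barrier_r.
have Oy : O y by apply: yO; rewrite subrr enorm0 ltW.
have M0 : 0 <= M := le_trans (normr_ge0 _) (uM y Oy).
have B0 : 0 <= B.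
  by rewrite /B !addr_ge0 // mulr_ge0 // ltW.
set rho : 'rV[R]_d -> R := fun x => enorm (x - y).
pose w x := u x - barrier A B (rho x).
have bar_le s : 0 <= s -> barrier A B s <= A * s.
  by move=> s0; rewrite /barrier gerBl mulr_ge0 ?divr_ge0 ?sqr_ge0.
have bar_ge0 s : 0 <= s -> s <= r -> 0 <= barrier A B s.
  move=> s0 sr; rewrite /barrier expr2 mulrA -mulrBl mulr_ge0 //.
  have : B * s <= B * r by exact: ler_wpM2l.
  have : 0 <= B * s by exact: mulr_ge0.
  lra.
have wmax : exists2 x0, [set x | rho x <= r] x0 &
    forall z, [set x | rho x <= r] z -> w z <= w x0.
  apply: usc_compact_max.
  - exact: compact_enorm_ball.
  - by exists y; rewrite /= /rho subrr enorm0 ltW.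
  - exists M => _ [x /= xr <-]; rewrite /w.
    have := bar_ge0 _ (enorm_ge0 _) xr.
    by have := ler_normlW (uM x (yO x xr)); rewrite /rho; lra.
  - move=> x xr a wa.
    (* Half of the gap goes to upper semicontinuity of u, half to continuity of the barrier. *)
    pose eps := (a - w x) / 2.
    have eps0 : 0 < eps by rewrite divr_gt0 ?subr_gt0.
    have cb : {for x, continuous (fun z => barrier A B (rho z))}.
      have cr : {for x, continuous rho}.
        exact: enorm_sub_continuous.
      apply: (@continuous_comp _ _ _ rho (barrier A B)) => //.
      exact: barrier_continuous.
    have un : \forall z \near x, u z < u x + eps.
      by apply: uusc; [exact: yO|rewrite ltrDl].
    have bn : \forall z \near x,
        `|barrier A B (rho x) - barrier A B (rho z)| < eps.
      by move/cvgrPdist_lt: cb; apply.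
    near=> z.
    have uz : u z < u x + eps by near: z; exact: un.
    have : `|barrier A B (rho x) - barrier A B (rho z)| < eps.
      by near: z; exact: bn.
    rewrite ltr_norml => /andP[_].
    by move: uz eps0; rewrite /eps /w; lra.
have [x0 x0r x0max] := wmax.
have wy : w y = u y.
  by rewrite /w /rho subrr enorm0 /barrier; ring.
suff wx0 : w x0 <= u y.
  move=> x xr; have := le_trans (x0max x xr) wx0; rewrite /w => h.
  by have := bar_le _ (enorm_ge0 (x - y)); rewrite /rho in h; lra.
rewrite leNgt; apply/negP => ltx0.
have Ox0 : O x0 by exact: yO.
have x0y : x0 != y by apply/eqP => x0y; move: ltx0; rewrite x0y wy ltxx.
(* On the sphere of radius r the barrier is at least 2 M, so [w x0] <= M - 2 M <= [u y]. *)
have x0r' : rho x0 < r.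
  rewrite lt_neqAle x0r andbT; apply/eqP => rE.
  have := ler_normlP _ _ (uM _ Ox0); have := ler_normlP _ _ (uM _ Oy).
  by move=> [? ?] [? ?]; move: ltx0; rewrite /w rE; lra.
(* The slope of the barrier at [x0], which is also the length of the gradient of the jet. *)
pose k := A - B * rho x0.
have rho0 : 0 < rho x0 by rewrite lt_def enorm_ge0 enorm_eq0 subr_eq0 x0y.
have k_bounds : 1 <= k <= A.
  have := ler_wpM2l B0 (ltW x0r'); have := mulr_ge0 B0 (ltW rho0).
  by rewrite /k => *; apply/andP; split; lra.
have e1 : enorm ((rho x0)^-1 *: (x0 - y)) = 1.
  by rewrite enormZ gtr0_norm ?invr_gt0 // mulVf // gt_eqF.
pose phi := barrier_jet A B (u x0) x0 y.
have phiE : u x0 = phi x0.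
  rewrite /phi /barrier_jet /quadratic subrr !dot0r.
  by rewrite expr0n /= !mulr0 !addr0.
have u_lt_phi : \forall x \near x0^', u x < phi x.
  have near_r : \forall x \near x0^', rho x < r.
    apply: nbhs_dnbhs.
    have rho_cont : {for x0, continuous rho} by exact: enorm_sub_continuous.
    exact: (cvgr_lt (rho x0) rho_cont _ x0r').
  have := barrier_jet_touches A B A0 (u x0) x0 y x0y => near_phi.
  (* Maximality of w at [x0] puts u below the translated barrier, which is strictly below the jet
     away from [x0]. *)
  near=> x; apply: (@le_lt_trans _ _
      (u x0 + (barrier A B (rho x) - barrier A B (rho x0)))).
    have : w x <= w x0 by apply: x0max; apply/ltW; near: x; exact: near_r.
    by rewrite /w; lra.
  by near: x; exact: near_phi.
have := uvisc x0 phi Ox0 (@quadratic_C2 _ _ _ _ _ _ _ _ _) phiE u_lt_phi.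
have k0 : 0 < k by have /andP[k1 _] := k_bounds; exact: lt_le_trans k1.
rewrite inf_laplacian_quadratic // grad_quadratic enormZ e1 mulr1 gtr0_norm // leNgt.
rewrite -/(rho x0) -/k.
move/negP; apply.
have := supersolution_slope _ _ _ _ k_bounds (uM x0 Ox0).
(* The A / s terms cancel: 2 (- A / s + A / s - (B - 1) / 2) = - (B - 1), with s = [rho x0]. *)
by congr (_ * _ + _ < 0); rewrite /B; field; rewrite gt_eqF.
Unshelve. all: by end_near. Qed.
End LocalBound.

(** * From balls of uniform radius to the compact set *)

Theorem lemma2p1 (R : realType) (d : nat) (hd : (0 < d)%N)
    (gamma : R) (hgamma : 0 <= gamma <= 2)
    (O : set 'rV[R]_d) (hO : domain O)
    (theta1 theta2 theta3 : R)
    (htheta1 : 0 < theta1) (htheta2 : 0 < theta2) (htheta3 : 0 < theta3)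
    (beta : R) (hbeta : 0 < beta <= 3 - gamma)
    (K : set 'rV[R]_d) (hK : compact K) (hKO : K `<=` O) :
  exists L : R -> R,
    forall u : 'rV[R]_d -> R,
      [bounded u x | x in O] ->
      viscosity_subsol gamma
        (fun _ r p => theta1 * enorm p `^ beta + theta2 * `|r| + theta3) O u ->
      forall x y : 'rV[R]_d, K x -> K y ->
        `|u x - u y| <= L (sup_norm O u) * enorm (x - y).
Proof.
have [_ oO _] := hO.
have [r0 r00 ballO] := compact_open_radius _ _ hK oO hKO.
have [_ gamma2] := andP hgamma; have [_ beta3] := andP hbeta.
(* B contains [theta1] A, so [theta1] r <= 1/2 is what keeps B r below A for large A. *)
pose r := Num.min r0 (2 * theta1)^-1.
have r_gt0 : 0 < r by rewrite lt_min r00 invr_gt0 mulr_gt0.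
have r_theta : theta1 * r <= 1 / 2.
  have : r <= (2 * theta1)^-1 by rewrite ge_min lexx orbT.
  rewrite -(ler_pM2l htheta1) => /le_trans; apply.
  by rewrite le_eqVlt; apply/orP; left; apply/eqP; field; rewrite gt_eqF.
pose C M := theta2 * M + theta3 + 2.
(* Chosen so that A / 2 + C r = A - 1 - 2 M / r, a bound for B r; this leaves slope at least 1 at
   radius r. The term 4 M / r makes the barrier reach 2 M there. *)
pose A M := 2 * C M * r + 2 + 4 * M / r.
(* The summand 2 M / r serves pairs at distance more than r. The radius r was fixed before u, so u
   enters only through M. *)
exists (fun M => A M + 2 * M / r) => u ub uvisc x y Kx Ky.
set M := sup_norm O u.
have uM z : O z -> `|u z| <= M.
  move=> Oz; apply: ub_le_sup; last by exists z.
  (* Boundedness only provides bounds strictly above N, hence N + 1. *)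
  have [N [_ /(_ (N + 1))]] := ub; rewrite ltrDl ltr01 => /(_ isT) h.
  by exists (N + 1) => _ [t Ot <-]; exact: h.
have M0 : 0 <= M := le_trans (normr_ge0 _) (uM x (hKO x Kx)).
have C0 : 0 < C M by rewrite /C ltr_wpDl // addr_ge0 ?mulr_ge0 // ltW.
have q0 : 0 <= M / r by rewrite divr_ge0 // ltW.
have qr : M / r * r = M by rewrite divfK // gt_eqF.
have Cr : 0 < C M * r by rewrite mulr_gt0.
have AE : A M = 2 * (C M * r) + 2 + 4 * (M / r) by rewrite /A; ring.
have A0 : 0 < A M by rewrite AE; lra.
pose B := theta1 * A M + theta2 * M + theta3 + 2.
have Br : B * r <= A M - 1 - 2 * (M / r).
  have -> : B * r = theta1 * r * A M + C M * r by rewrite /B /C; ring.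
  have := ler_wpM2r (ltW A0) r_theta; move: AE; lra.
have near_le a b : K a -> K b -> enorm (a - b) <= r ->
    u a <= u b + A M * enorm (a - b).
  move=> Ka Kb ab; apply: (viscosity_local_bound _ _ _ _ _ gamma2 beta3
    (ltW htheta1) (ltW htheta2) (ltW htheta3) O u M (A M) r b uvisc uM _ A0 r_gt0) ab.
  - move=> z zr; apply: (ballO b) => //; apply: (le_trans (normr_le_enorm _)).
    by apply: (le_trans zr); rewrite ge_min lexx.
  - by rewrite -/B; lra.
  (* The bound on B r gives psi(r) >= (A r + r + 2 M) / 2, and A r >= 4 M. *)
  - rewrite -/B /barrier.
    have Cr2 : 0 <= C M * r * r by rewrite mulr_ge0 ?ltW.
    have := ler_wpM2r (ltW r_gt0) Br.
    have -> : (A M - 1 - 2 * (M / r)) * r = A M * r - r - 2 * (M / r * r) by ring.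
    have -> : A M * r = 2 * (C M * r * r) + 2 * r + 4 * (M / r * r).
      by rewrite /A; ring.
    rewrite qr; lra.
have [xyr|rxy] := leP (enorm (x - y)) r.
  have xy := near_le x y Kx Ky xyr.
  have := near_le y x Ky Kx; rewrite -[y - x]opprB enormN => /(_ xyr) yx.
  have : 0 <= 2 * M / r * enorm (x - y) by rewrite !mulr_ge0 ?invr_ge0 ?enorm_ge0 // ltW.
  by rewrite ler_norml (mulrDl (A M)) => ?; apply/andP; split; lra.
(* For distant points, |u x - u y| <= 2 M <= (2 M / r) |x - y|. *)
have : M <= M / r * enorm (x - y) by rewrite -[leLHS]qr ler_wpM2l // ltW.
have : 0 <= A M * enorm (x - y) by rewrite mulr_ge0 ?enorm_ge0 // ltW.
have := uM x (hKO x Kx); have := uM y (hKO y Ky).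
rewrite !ler_norml (mulrDl (A M)) => /andP[? ?] /andP[? ?] ? ?.
by rewrite -[2 * M / r]mulrA; apply/andP; split; lra.
Qed.
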